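(* Linear boolean-width and total twin-width are functionally equivalent: there is a function $f:\mathbb N\to\mathbb N$ such that for every finite graph $G$, $\mathrm{ttww}(G)\le f(\mathrm{lboolw}(G))$ and $\mathrm{lboolw}(G)\le f(\mathrm{ttww}(G))$, where $\mathrm{lboolw}$ denotes linear boolean-width and $\mathrm{ttww}$ total twin-width.
   Context: Graphs are finite and simple. For a bipartition $(X,Y)$ of $V(G)$, $\mathrm{bool}(X,Y)$ is $\log_2$ of the number of distinct subsets of $Y$ of the form $N(S)\cap Y$ with $S\subseteq X$. A branch decomposition of $G$ is a tree whose internal nodes have degree 3 and whose leaves are in bijection with $V(G)$; each tree edge induces the bipartition of $V(G)$ given by the leaf sets of the two components after its removal. It is linear if its internal nodes form a path. The linear boolean-width of $G$ is the minimum over linear branch decompositions of the maximum of $\mathrm{bool}$ over the bipartitions induced by its edges. A partition sequence of an $n$-vertex graph $G$ is a sequence $\mathcal P_n,\dots,\mathcal P_1$ of partitions of $V(G)$ where $\mathcal P_n$ consists of singletons, $\mathcal P_1=\{V(G)\}$, and each $\mathcal P_i$ is obtained from $\mathcal P_{i+1}$ by merging two parts. Two disjoint vertex sets $X,Y$ are homogeneous if all or none of the pairs $x\in X$, $y\in Y$ are edges. For a partition $\mathcal P$, its red edges are the pairs of distinct non-homogeneous parts together with one red loop at each part having at least two vertices. The total twin-width $\mathrm{ttww}(G)$ is the minimum over partition sequences of the maximum over $i$ of the number of red edges (loops included) of $\mathcal P_i$. *)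

(* Defs.v *)
From HB Require Import structures.
From mathcomp Require Import all_boot all_order all_algebra.
From mathcomp Require Import boolp reals exp.

Set Implicit Arguments.
Unset Strict Implicit.
Unset Printing Implicit Defensive.

Import Order.TTheory GRing.Theory Num.Theory.

Record sgraph := SGraph {
  vertex :> finType;
  adj : rel vertex;
  adj_sym : symmetric adj;
  adj_irr : irreflexive adj }.

Section Neighbourhoods.
Variable G : sgraph.
Implicit Types (X Y S : {set G}) (x : G).

Definition neigh x : {set G} := [set y | adj x y].

Definition degree x : nat := #|neigh x|.

Definition neighs S : {set G} := \bigcup_(x in S) neigh x.

Definition bool_traces X Y : {set {set G}} :=
  [set neighs S :&: Y | S : {set G} in powerset X].

Definition homogeneous X Y : bool :=
  [forall x in X, forall y in Y, adj x y]
  || [forall x in X, forall y in Y, ~~ adj x y].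

End Neighbourhoods.

Definition log2 (R : realType) (x : R) : R := (ln x / ln 2)%R.

Definition boolcut (R : realType) (G : sgraph) (X Y : {set G}) : R :=
  log2 (#|bool_traces X Y|%:R)%R.

(* A cycle has length at least 3: [ucycle] also accepts the sequence [:: x; y]
   for an edge xy. *)
Definition is_tree (T : sgraph) : Prop :=
  [/\ 0 < #|T|, (forall x y : T, connect (@adj T) x y)
    & forall c : seq T, ucycle (@adj T) c -> size c < 3].

(* "<= 1" rather than "== 1", so that the node of the one-node tree is a
   leaf. *)
Definition is_leaf (T : sgraph) (x : T) : bool := degree x <= 1.

Record branch_dec (G : sgraph) := BranchDec {
  bd_tree : sgraph;
  bd_treeP : is_tree bd_tree;
  bd_internalP : forall x : bd_tree, ~~ is_leaf x -> degree x = 3;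
  bd_leaf : G -> bd_tree;
  bd_leaf_inj : injective bd_leaf;
  bd_leaf_codom : forall x : bd_tree, (x \in codom bd_leaf) = is_leaf x }.

(* In a tree, any path through the internal nodes is an induced path. *)
Definition linear_bd (G : sgraph) (D : branch_dec G) : Prop :=
  exists p : seq (bd_tree D),
    [/\ uniq p, sorted (@adj (bd_tree D)) p
      & forall x, (x \in p) = ~~ is_leaf x].

Section Width.
Variables (R : realType) (G : sgraph) (D : branch_dec G).
Implicit Types x y : bd_tree D.

Definition remove_edge x y : rel (bd_tree D) :=
  fun u v => adj u v && ([set u; v] != [set x; y]).

Definition side x y : {set G} :=
  [set v | connect (remove_edge x y) x (bd_leaf D v)].

(* Each tree edge is met in both orientations. The default value 0 only matters
   for the one-node tree. *)
Definition bd_width : R :=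
  \big[Num.max/0%R]_(p : bd_tree D * bd_tree D | adj p.1 p.2)
     boolcut R (side p.1 p.2) (side p.2 p.1).

End Width.

(* This infimum is a minimum, see [lboolwP]; it is 0 if G has no vertex. *)
Definition lboolw (R : realType) (G : sgraph) : R :=
  inf (fun w : R => exists2 D : branch_dec G, linear_bd D & w = bd_width R D).

Section TotalTwinWidth.
Variable G : sgraph.
Implicit Types (A B : {set G}) (P Q : {set {set G}}).

Definition merges P Q : bool :=
  [exists A in P, exists B in P,
     (A != B) && (Q == (A :|: B) |: (P :\ A :\ B))].

Definition partition_seq (s : #|G|.-tuple {set {set G}}) : bool :=
  [&& all (fun P => partition P [set: G]) s,
      head set0 s == [set [set x] | x : G],
      last set0 s == [set [set: G]]
    & sorted merges s].

Definition red_pairs P : {set {set {set G}}} :=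
  [set E | [exists A in P, exists B in P,
     [&& A != B, ~~ homogeneous A B & E == [set A; B]]]].

Definition red_loops P : {set {set G}} := [set A in P | 2 <= #|A|].

Definition nb_red P : nat := #|red_pairs P| + #|red_loops P|.

Definition seq_width (s : #|G|.-tuple {set {set G}}) : nat :=
  \max_(P <- s) nb_red P.

(* There is a partition sequence unless G has no vertex; then ttww is 0. *)
Definition ttww : nat :=
  if [pick s | partition_seq s] is Some s0
  then seq_width [arg min_(s < s0 | partition_seq s) seq_width s]
  else 0.

Lemma ttwwP (s0 : #|G|.-tuple {set {set G}}) : partition_seq s0 ->
  (exists2 s : #|G|.-tuple {set {set G}},
     partition_seq s & ttww = seq_width s) /\
  (forall s : #|G|.-tuple {set {set G}},
     partition_seq s -> ttww <= seq_width s).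
Proof.
rewrite /ttww; case: pickP => [s1 s1P _|none s0P]; last by rewrite none in s0P.
by case: arg_minnP => // s sP smin; split; first by exists s.
Qed.

End TotalTwinWidth.

Section Minimum.
Variables (R : realType) (G : sgraph).
Local Open Scope ring_scope.

Let traces (D : branch_dec G) : nat :=
  maxn 1 (\max_(p : bd_tree D * bd_tree D | adj p.1 p.2)
     #|bool_traces (side p.1 p.2) (side p.2 p.1)|).

Let log2_le (m n : nat) : (0 < m)%N -> (m <= n)%N ->
  log2 (m%:R : R) <= log2 n%:R.
Proof.
move=> m0 mn; rewrite /log2 ler_wpM2r //.
  by rewrite invr_ge0 ln_ge0 // ler1n.
by rewrite ler_ln ?ler_nat // posrE ltr0n // (leq_trans m0 mn).
Qed.

Let log2_max (m n : nat) : (0 < m)%N -> (0 < n)%N ->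
  log2 ((maxn m n)%:R : R) = Num.max (log2 m%:R) (log2 n%:R).
Proof.
move=> m0 n0; case: (leqP m n) => [mn|/ltnW nm].
  by rewrite max_r // log2_le.
by rewrite max_l // log2_le.
Qed.

Let bool_traces_gt0 (X Y : {set G}) : (0 < #|bool_traces X Y|)%N.
Proof.
apply/card_gt0P; exists (neighs set0 :&: Y)%SET.
by apply/imsetP; exists set0; rewrite // powersetE sub0set.
Qed.

Let widthE (D : branch_dec G) : bd_width R D = log2 (traces D)%:R.
Proof.
rewrite /bd_width /traces.
have -> : (0 : R) = log2 1%:R by rewrite /log2 ln1 mul0r.
apply: (big_ind2 (fun (x : R) (n : nat) => x = log2 (maxn 1 n)%:R)).
- by [].
- move=> x m y n -> ->; rewrite -log2_max ?leq_max //.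
  by rewrite maxnACA.
- by move=> p _; rewrite (maxn_idPr _).
Qed.

Lemma lboolwP (D0 : branch_dec G) : linear_bd D0 ->
  (exists2 D : branch_dec G, linear_bd D & lboolw R G = bd_width R D) /\
  (forall D : branch_dec G, linear_bd D -> lboolw R G <= bd_width R D).
Proof.
move=> lD0.
pose A n := `[< exists2 D : branch_dec G, linear_bd D & traces D = n >].
have exA : exists n, A n by exists (traces D0); apply/asboolP; exists D0.
case: (ex_minnP exA) => n /asboolP[D lD Dn] minn.
have lb (D' : branch_dec G) : linear_bd D' -> bd_width R D <= bd_width R D'.
  move=> lD'; rewrite !widthE; apply: log2_le; first by rewrite /traces leq_max.
  by rewrite Dn; apply: minn; apply/asboolP; exists D'.
suff E : lboolw R G = bd_width R D.
  by split; [exists D | move=> D' lD'; rewrite E lb].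
apply/eqP; rewrite eq_le; apply/andP; split.
  apply: ge_inf; last by exists D.
  by exists (bd_width R D) => _ [D' lD' ->]; exact: lb.
apply: lb_le_inf; first by exists (bd_width R D), D.
by move=> _ [D' lD' ->]; exact: lb.
Qed.

End Minimum.

(* Main.v *)
Require Import Defs.
From mathcomp Require Import all_boot all_order all_algebra.
From mathcomp Require Import boolp reals exp.
From mathcomp Require Import zify.
From mathcomp Require classical_sets.

Set Implicit Arguments.
Unset Strict Implicit.
Unset Printing Implicit Defensive.

Import Order.TTheory GRing.Theory Num.Theory.

(* Both parameters are compared with vertex orderings all of whose initial
   segments X have few traces N(S) \ X with S in X.

   From an ordering to a partition sequence: while two parts inside X have the
   same neighbourhood outside X, merge them; otherwise the number of parts
   inside X is at most the number of traces, and X is extended by the next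
   vertex. The vertices outside X stay singletons that are homogeneous to all
   parts, so red edges only occur inside X. From an ordering to a branch
   decomposition: use the caterpillar whose leaves appear in that order.

   Conversely, the vertices are sorted into layers of bounded size, which costs
   only a constant factor in the number of traces. For a linear branch
   decomposition the layer of v is the position on the spine of the neighbour
   of its leaf. For a partition sequence it is the first time when v lies in a
   part with two vertices: the red loops bound the number of such parts, and
   the red pairs bound the number of singletons which are not homogeneous to
   them. *)

(** * Traces *)

Section BoolTraces.
Variable G : sgraph.
Implicit Types (X Y A B S U : {set G}).

Lemma in_neighs S y : (y \in neighs S) = [exists x in S, adj x y].
Proof.
apply/bigcupP/exists_inP => -[x xS].
  by rewrite inE => xy; exists x.
by move=> xy; exists x; rewrite ?inE.
Qed.

Lemma neighsU A B : neighs (A :|: B) = neighs A :|: neighs B.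
Proof. exact: bigcup_setU. Qed.

Lemma bool_tracesP X Y U :
  reflect (exists2 S : {set G}, S \subset X & U = neighs S :&: Y)
          (U \in bool_traces X Y).
Proof.
by apply: (iffP imsetP) => -[S SX ->]; exists S; rewrite ?powersetE // in SX *.
Qed.

Lemma card_bool_traces_le_pow X Y : #|bool_traces X Y| <= 2 ^ #|X|.
Proof. by rewrite -card_powerset; apply: leq_imset_card. Qed.

Lemma card_bool_traces_mono X X' Y Y' : X \subset X' -> Y \subset Y' ->
  #|bool_traces X Y| <= #|bool_traces X' Y'|.
Proof.
move=> sX sY.
apply: leq_trans (leq_imset_card (fun T => T :&: Y) (bool_traces X' Y')).
apply/subset_leq_card/subsetP => _ /bool_tracesP[S SX ->].
apply/imsetP; exists (neighs S :&: Y').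
  by apply/bool_tracesP; exists S => //; apply: subset_trans sX.
by rewrite -setIA (setIidPr sY).
Qed.

(** The trace of [S] is recovered from the trace of [S :&: A] and the set [S :&: B] itself. *)
Lemma card_bool_traces_setU A B Y :
  #|bool_traces (A :|: B) Y| <= #|bool_traces A Y| * 2 ^ #|B|.
Proof.
rewrite -card_powerset -cardsX.
apply: leq_trans (leq_imset_card (fun p => p.1 :|: (neighs p.2 :&: Y)) _).
apply/subset_leq_card/subsetP => _ /bool_tracesP[S SX ->].
apply/imsetP; exists (neighs (S :&: A) :&: Y, S :&: B).
  rewrite in_setX /= powersetE subsetIr andbT.
  by apply/bool_tracesP; exists (S :&: A); rewrite ?subsetIr.
by rewrite /= -setIUl -neighsU -setIUr (setIidPl SX).
Qed.

(* The sets [U] and [neighs (Y :\: U) :&: X] determine each other: the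
   complement of the latter in [X] is the largest set with trace [U]. *)
Lemma leq_card_bool_tracesC X Y : #|bool_traces X Y| <= #|bool_traces Y X|.
Proof.
pose phi U := neighs (Y :\: U) :&: X.
pose psi U := neighs (X :\: U) :&: Y.
have phiK : {in bool_traces X Y, cancel phi psi}.
  move=> _ /bool_tracesP[S SX ->]; set U := neighs S :&: Y.
  apply/setP => y; rewrite !inE in_neighs.
  apply/andP/idP => [[/exists_inP[x]]|].
    rewrite !inE in_neighs negb_and => /andP[xN xX xy yY].
    apply: contraLR xN => yU; rewrite xX orbF negbK.
    by apply/exists_inP; exists y; rewrite ?inE ?yU // adj_sym.
  rewrite in_neighs => /andP[/exists_inP[x xS xy] yY]; split=> //.
  apply/exists_inP; exists x => //; rewrite !inE (subsetP SX) // !andbT.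
  rewrite in_neighs; apply/exists_inP => -[z].
  rewrite !inE in_neighs => /andP[zU zY] zx; case/negP: zU; rewrite zY andbT.
  by apply/exists_inP; exists x; rewrite // adj_sym.
rewrite -(card_in_imset (can_in_inj phiK)).
apply/subset_leq_card/subsetP => _ /imsetP[U _ ->].
by apply/bool_tracesP; exists (Y :\: U); rewrite ?subsetDl.
Qed.

Lemma card_bool_tracesC X Y : #|bool_traces X Y| = #|bool_traces Y X|.
Proof. by apply/eqP; rewrite eqn_leq !leq_card_bool_tracesC. Qed.

(* Sorting the vertices by layer, each initial segment is a union of layers
   plus a part of one layer. *)
Lemma linear_order_of_layers (h : G -> nat) (d M : nat) :
  (forall j, #|[set v | h v == j]| <= d) ->
  (forall j, #|bool_traces [set v | h v < j] (~: [set v | h v < j])| <= M) ->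
  exists s : seq G, [/\ uniq s, forall v, v \in s
    & forall i, #|bool_traces [set v in take i s] (~: [set v in take i s])|
                <= M * 2 ^ d].
Proof.
move=> fib cut.
pose le := relpre h leq.
have le_total : total le by move=> x y; apply: leq_total.
have le_tr : transitive le by move=> y x z; apply: leq_trans.
exists (sort le (enum G)); split=> [|v|i].
- by rewrite sort_uniq enum_uniq.
- by rewrite mem_sort mem_enum.
set s := sort le _; set X := [set v in take i s].
have [j [lo hi]] : exists j, [set v | h v < j] \subset X /\
    X \subset [set v | h v < j] :|: [set v | h v == j].
  have: sorted le s by apply: sort_sorted.
  have: forall v, v \in s by move=> v; rewrite mem_sort mem_enum.
  rewrite /X -{1 2}(cat_take_drop i s).
  case: (lastP (take i s)) => [|t x] s_all.
    by exists 0; split; apply/subsetP => v; rewrite !inE.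
  rewrite (sorted_pairwise le_tr) pairwise_cat pairwise_rcons.
  case/and3P=> /allrelP ts /andP[/allP tx _] _.
  (* Here [x] is the last vertex of the prefix: since [s] is sorted, all vertices of smaller layers
     come before [x] and none of a larger layer does. *)
  exists (h x); split; apply/subsetP => v; rewrite !inE.
    move=> vx; have:= s_all v; rewrite mem_cat => /orP[//|vr].
    have /= := ts x v _ vr; rewrite mem_rcons mem_head => /(_ isT).
    by rewrite leqNgt vx.
  rewrite orbC -leq_eqVlt mem_rcons inE => /orP[/eqP->//|]; exact: tx.
apply: leq_trans (card_bool_traces_mono hi _) _; last first.
  apply: leq_trans (card_bool_traces_setU _ _ _) _.
  by apply: leq_mul; [exact: (cut j)| rewrite leq_exp2l].
by rewrite setCS.
Qed.
End BoolTraces.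

(** * From orderings to partition sequences *)

Section Merge.
Variables (T : finType) (P : {set {set T}}) (A B : {set T}).
Hypotheses (partP : partition P [set: T]) (AP : A \in P) (BP : B \in P).
Hypothesis neqAB : A != B.
Let Q := (A :|: B) |: (P :\ A :\ B).

Lemma partition_merge : partition Q [set: T].
Proof.
have BPA : B \in P :\ A by rewrite !inE eq_sym neqAB.
have := partitionD1 (partitionD1 partP AP) BPA;
  rewrite [[set: T] :\: A :\: B]setDDl => partD.
have := @partitionU1 _ _ _ (A :|: B) partD; rewrite setTD setUCr; apply.
  by rewrite setU_eq0 negb_and (partition_neq0 partP AP).
by rewrite -setI_eq0 setICr.
Qed.

Lemma card_merge : #|Q|.+1 = #|P|.
Proof.
have BPA : B \in P :\ A by rewrite !inE eq_sym neqAB.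
rewrite (cardsD1 A P) AP (cardsD1 B (P :\ A)) BPA /Q cardsU1.
(* The union is a new part: another part of [P] cannot meet [A]. *)
suff -> : A :|: B \notin P :\ A :\ B by [].
apply/negP; rewrite !inE => /and3P[_ ABA ABP].
have /trivIsetP/(_ _ _ ABP AP ABA) := partition_trivIset partP.
rewrite -setI_eq0 setIUl setIid setU_eq0 => /andP[A0 _].
by move: (partition_neq0 partP AP); rewrite A0.
Qed.

End Merge.

Lemma partition_set1 (T : finType) : partition [set [set x] | x : T] [set: T].
Proof.
apply/and3P; split.
- rewrite cover_imset; apply/eqP/setP => x; rewrite inE.
  by apply/bigcupP; exists x; rewrite ?inE.
- apply/trivIsetP => _ _ /imsetP[x _ ->] /imsetP[y _ ->] xy.
  by rewrite disjoints1 inE; apply: contraNneq xy => ->.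
- by apply/imsetP => -[x _ /setP/(_ x)]; rewrite !inE eqxx.
Qed.

Section OrderToPartitionSequence.
Variables (G : sgraph) (s : seq G) (M : nat).
Hypothesis s_all : forall v, v \in s.
Let X i : {set G} := [set v in take i s].
Hypothesis cutM : forall i, #|bool_traces (X i) (~: X i)| <= M.
Implicit Types (A B : {set G}) (P Q : {set {set G}}).

Let inside i P : {set {set G}} := [set A in P | A \subset X i].

(* The vertices outside the initial segment [X i] are still singletons, and the
   vertices of a part have the same neighbours outside [X i]. *)
Let good i P :=
  [/\ partition P [set: G],
      {in P, forall A, A \subset X i \/ exists2 y, y \notin X i & A = [set y]},
      {in P, forall A, {in A, forall a y, y \notin X i ->
         adj a y = (y \in neighs A)}}
    & #|inside i P| <= M.+1].

Let X_size : X (size s) = [set: G].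
Proof. by apply/setP => v; rewrite !inE take_size s_all. Qed.

(** As the two parts agree outside [X i], every vertex of the union has the outside neighbours of
    the whole union. One inside part replaces two, so the bound on their number survives. *)
Let good_step_in i P A B : good i P -> A \in inside i P -> B \in inside i P ->
  A != B -> neighs A :&: ~: X i = neighs B :&: ~: X i ->
  good i ((A :|: B) |: (P :\ A :\ B)).
Proof.
case=> partP sP hP cP; rewrite !inE => /andP[AP AX] /andP[BP BX] neqAB eqN.
have eqN' y : y \notin X i -> (y \in neighs A) = (y \in neighs B).
  by move=> yX; move/setP/(_ y): eqN; rewrite !in_setI in_setC yX !andbT.
split=> [|C|C|].
- exact: partition_merge.
- rewrite !inE => /orP[/eqP->|/and3P[_ _ /sP//]].
  by left; rewrite subUset AX.
- rewrite !inE => /orP[/eqP->|/and3P[_ _ /hP//]] a aAB y yX.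
  rewrite neighsU inE eqN' // orbb.
  by case/setUP: aAB => [/hP->|/hP->] //; rewrite eqN'.
- have sub : inside i ((A :|: B) |: (P :\ A :\ B)) \subset
      (A :|: B) |: (inside i P :\ A :\ B).
    apply/subsetP => C; rewrite !inE => /andP[/orP[->//|/and3P[-> -> ->] ->]].
    by rewrite orbT.
  apply: leq_trans (subset_leq_card sub) _; apply: leq_trans cP.
  rewrite (cardsD1 A (inside i P)) (cardsD1 B (inside i P :\ A)).
  by rewrite !inE AP AX BP BX eq_sym neqAB cardsU1 addnA leq_add2r;
    case: (_ \notin _).
Qed.

(** A part inside [X i.+1] but not inside [X i] is the singleton of the new vertex. This one extra
    part is why [good] allows [M.+1] inside parts. *)
Let good_shift i P : i < size s -> good i P -> #|inside i P| <= M ->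
  good i.+1 P.
Proof.
move=> lt_i [partP sP hP _] cP.
have [v Xv] : exists v, X i.+1 = v |: X i.
  have [x0 _] : exists x : G, true by case: s lt_i => // x; exists x.
  exists (nth x0 s i); apply/setP => z.
  by rewrite !inE (take_nth x0 lt_i) mem_rcons inE.
have sX : X i \subset X i.+1 by rewrite Xv subsetUr.
split=> // [A AP|A AP a aA y|].
- have [AX|[y yX ->]] := sP A AP; first by left; apply: subset_trans sX.
  have [->|yv] := eqVneq y v; first by left; rewrite sub1set Xv setU11.
  by right; exists y; rewrite // Xv in_setU1 negb_or yv yX.
- by move=> yX; apply: hP => //; apply: contra yX; apply: (subsetP sX).
- have sub : inside i.+1 P \subset [set v] |: inside i P.
    apply/subsetP => A; rewrite !inE => /andP[AP]; rewrite AP /=.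
    have [->|[y yX ->]] := sP A AP; first by rewrite orbT.
    rewrite sub1set Xv in_setU1 (negbTE yX) orbF.
    by move/eqP->; rewrite eqxx.
  apply: leq_trans (subset_leq_card sub) _.
  by rewrite cardsU1 -add1n leq_add // leq_b1.
Qed.

(** Induction on the number of vertices outside [X i]: either two inside parts have the same trace
    and can be merged, or the segment grows by one vertex. *)
Let good_step i P : i <= size s -> good i P -> 1 < #|P| ->
  exists Q j, [/\ merges P Q, j <= size s & good j Q].
Proof.
move Dk: (size s - i) => k; elim: k i Dk => [|k IH] i Dk le_i gP P_gt1;
  case: (boolP [exists A in inside i P, exists B in inside i P, (A != B) &&
    (neighs A :&: ~: X i == neighs B :&: ~: X i)]) => [|no].
1,3: case/exists_inP=> A Ain /exists_inP[B Bin /andP[neqAB /eqP eqN]];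
  exists ((A :|: B) |: (P :\ A :\ B)), i; split => //;
  [move: Ain Bin; rewrite !inE => /andP[AP _] /andP[BP _];
   apply/exists_inP; exists A => //; apply/exists_inP; exists B => //;
   by rewrite neqAB eqxx | exact: good_step_in].
(* Nothing is left outside, so all traces are empty and any two parts can be merged. *)
- have Di : i = size s by apply/eqP; rewrite eqn_leq le_i -subn_eq0 Dk.
  case/card_gt1P: P_gt1 => A [B [AP BP neqAB]]; case/negP: no.
  apply/exists_inP; exists A; first by rewrite inE AP Di X_size subsetT.
  apply/exists_inP; exists B; first by rewrite inE BP Di X_size subsetT.
  by rewrite neqAB Di X_size setCT !setI0 eqxx.
have lt_i : i < size s by rewrite -subn_gt0 Dk.
apply: (IH i.+1) => //; first by rewrite subnS Dk.
apply: good_shift => //.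
apply: leq_trans (cutM i).
(* Without a mergeable pair, distinct inside parts have distinct traces, so there are at most [M] of
   them. *)
have inj : {in inside i P &, injective (fun A => neighs A :&: ~: X i)}.
  move=> A B Ain Bin eqN; apply: contraNeq no => neqAB.
  apply/exists_inP; exists A => //; apply/exists_inP; exists B => //.
  by rewrite neqAB eqN eqxx.
rewrite -(card_in_imset inj).
apply/subset_leq_card/subsetP => _ /imsetP[A + ->].
by rewrite inE => /andP[_ AX]; apply/bool_tracesP; exists A.
Qed.

(** Both parts of a red pair lie inside [X i], so the square counts ordered pairs of inside parts.
    The other summand counts the loops, which also sit at inside parts. *)
Let good_nb_red i P : good i P -> nb_red P <= M.+1 ^ 2 + M.+1.
Proof.
case=> partP sP hP cP; rewrite /nb_red.
have hom (A : {set G}) y : A \in P -> y \notin X i ->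
    homogeneous A [set y] && homogeneous [set y] A.
  move=> AP yX; have hA a : a \in A -> adj a y = (y \in neighs A).
    by move=> aA; apply: hP.
  case yA: (y \in neighs A); apply/andP; split; apply/orP;
    [left|left|right|right];
    apply/forall_inP => a; rewrite ?inE => aA; apply/forall_inP => b;
    rewrite ?inE => bA; rewrite ?(eqP aA) ?(eqP bA) ?hA ?yA //;
    by rewrite adj_sym hA ?yA.
apply: leq_add.
  apply: leq_trans (leq_mul cP cP); rewrite -cardsX.
  apply: leq_trans (leq_imset_card (fun p => [set p.1; p.2]) _).
  apply/subset_leq_card/subsetP => E.
  rewrite inE => /exists_inP[A AP /exists_inP[B BP]].
  case/and3P=> neqAB nh /eqP->; apply/imsetP; exists (A, B) => //.
  rewrite in_setX /= 2!inE AP BP /=.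
  apply/andP; split; apply: contraNT nh => nX.
    case: (sP A AP) => [AX|[y yX ->]]; first by rewrite AX in nX.
    by case/andP: (hom B y BP yX).
  case: (sP B BP) => [BX|[y yX ->]]; first by rewrite BX in nX.
  by case/andP: (hom A y AP yX).
apply: leq_trans cP; apply/subset_leq_card/subsetP => A.
rewrite !inE => /andP[AP A2]; rewrite AP /=.
by case: (sP A AP) => // -[y _ Ay]; rewrite Ay cards1 in A2.
Qed.

(** Each merge removes one part, so [m] merges leave a single part; the initial segment may grow
    between merges. *)
Let good_seq m i P : i <= size s -> good i P -> #|P| = m.+1 ->
  exists t, [/\ path (@merges G) P t, size t = m, last P t = [set [set: G]]
    & {in P :: t, forall Q, exists j, good j Q}].
Proof.
elim: m i P => [|m IH] i P le_i gP cP.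
  exists [::]; split=> //=; last by move=> Q; rewrite inE => /eqP->; exists i.
  case/eqP/cards1P: cP => C PC; case: gP => /cover_partition.
  by rewrite PC /cover big_set1 => ->.
have [Q [j [PQ le_j gQ]]] : exists Q j, [/\ merges P Q, j <= size s & good j Q].
  by apply: (good_step le_i); rewrite ?cP.
have cQ : #|Q| = m.+1.
  case/exists_inP: PQ => A AP /exists_inP[B BP /andP[neqAB /eqP->]].
  by apply: succn_inj; rewrite -cP card_merge //; case: gP.
have [t [Pt st lt gt]] := IH j Q le_j gQ cQ.
exists (Q :: t); split=> //=; [by rewrite PQ | by rewrite st |].
by move=> C; rewrite inE => /orP[/eqP->|/gt//]; exists i.
Qed.

Lemma partition_seq_of_order : 0 < #|G| ->
  exists2 t : #|G|.-tuple {set {set G}},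
    partition_seq t & seq_width t <= M.+1 ^ 2 + M.+1.
Proof.
move=> G_gt0; set P := [set [set x] | x : G].
have cP : #|P| = #|G|.-1.+1.
  by rewrite prednK // card_imset //; apply: set1_inj.
have gP : good 0 P.
  split=> [|A|A|]; first exact: partition_set1.
  - by case/imsetP=> x _ ->; right; exists x; rewrite // inE take0.
  - case/imsetP=> x _ -> a /set1P-> y _; rewrite in_neighs.
    apply/idP/exists_inP => [xy|[z /set1P->//]].
    by exists x; rewrite ?inE.
  - rewrite (_ : inside 0 P = set0) ?cards0 //.
    apply/setP => A; rewrite !inE; apply/negP => /andP[/imsetP[x _ ->]].
    by rewrite sub1set inE take0.
have [t [Pt st lt gt]] := good_seq (leq0n _) gP cP.
have size_t : size (P :: t) == #|G| by rewrite /= st prednK.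
exists (Tuple size_t).
  apply/and4P; split; [|exact: eqxx|by rewrite /= lt|exact: Pt].
  by apply/allP => Q /gt[j []].
by apply/bigmax_leqP_seq => Q /gt[j gQ] _; apply: good_nb_red gQ.
Qed.

End OrderToPartitionSequence.

(** * From orderings to branch decompositions *)

Lemma connect_invariant (T : finType) (e : rel T) (K : {set T}) x y :
  (forall u v, u \in K -> e u v -> v \in K) -> x \in K -> connect e x y ->
  y \in K.
Proof.
move=> Ke + /connectP[p + ->]; elim: p x => //= z p IH x xK /andP[xz].
by apply: IH; apply: Ke xz.
Qed.

(* In a cycle, the two neighbours of a vertex of minimal rank would both be
   its unique neighbour of larger rank. *)
Lemma acyclic_of_rank (T : sgraph) (r : T -> nat) :
  (forall x y : T, adj x y -> r x != r y) ->
  (forall x y z : T, adj x y -> adj x z -> r x < r y -> r x < r z -> y = z) ->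
  forall c : seq T, ucycle (@adj T) c -> size c < 3.
Proof.
move=> neq_r uniq_r c; rewrite ltnNge; case/andP=> cc uc.
apply/negP => c_ge3.
have [x0 x0c] : exists x, x \in c by case: c c_ge3 {cc uc} => // x c; exists x;
  apply: mem_head.
case: (@arg_minnP _ x0 (mem c) r x0c) => x xc xmin.
have up y : y \in c -> adj x y -> r x < r y.
  by move=> yc xy; rewrite ltn_neqAle neq_r // xmin.
have [i c' Dc'] := rot_to xc.
move: cc uc c_ge3; rewrite -(rot_cycle i) -(rot_uniq i) -(size_rot i) Dc'.
have sub y : y \in x :: c' -> y \in c by rewrite -Dc' mem_rot.
case: c' {Dc'} sub => [|a [|b q]] // sub /=.
rewrite rcons_path => /and3P[xa ab /andP[_ lx]] /and3P[_ abq _] _.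
case/negP: abq; rewrite (uniq_r x a (last b q)) ?mem_last //.
- by rewrite adj_sym.
- by apply: up xa; apply: sub; rewrite !inE eqxx orbT.
- apply: up; last by rewrite adj_sym.
  by apply: sub; rewrite 2!inE mem_last !orbT.
Qed.

(** If [xy] is the only edge leaving [K], its removal confines the component of [x] to [K] and that
    of [y] to the complement. Monotonicity of traces then gives the bound. *)
Lemma card_bool_traces_side (G : sgraph) (D : branch_dec G)
    (x y : bd_tree D) (K : {set bd_tree D}) :
  x \in K -> y \notin K ->
  (forall u v : bd_tree D, adj u v -> u \in K -> v \notin K ->
    u = x /\ v = y) ->
  let Z := [set v | bd_leaf D v \in K] in
  #|bool_traces (side x y) (side y x)| <= #|bool_traces Z (~: Z)|.
Proof.
move=> xK yK cross /=; apply: card_bool_traces_mono; apply/subsetP => v.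
  rewrite !inE; apply: connect_invariant => // u w uK /andP[uw].
  by apply: contraNT => wK; have [-> ->] := cross u w uw uK wK.
rewrite !inE -in_setC; apply: connect_invariant; last by rewrite inE.
move=> u w; rewrite !inE => uK /andP[uw]; apply: contraNN => wK.
rewrite adj_sym in uw.
by have [-> ->] := cross w u uw wK uK; rewrite setUC.
Qed.

(* The path 0, 1, ..., n together with a pendant leaf at each interior node
   of the path; [(i, true)] is the leaf hanging at [(i, false)]. *)
Section Caterpillar.
Variable n : nat.

Definition cat_node := {x : 'I_n.+1 * bool | x.2 ==> (0 < x.1 < n)}.

Definition cat_pos (x : cat_node) : nat := (val x).1.
Definition cat_pendant (x : cat_node) : bool := (val x).2.

Definition cat_adj : rel cat_node := fun x y =>
  if cat_pendant x (+) cat_pendant y then cat_pos x == cat_pos y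
  else ~~ cat_pendant x &&
    (((cat_pos x).+1 == cat_pos y) || ((cat_pos y).+1 == cat_pos x)).

Lemma cat_adj_sym : symmetric cat_adj.
Proof.
move=> x y; rewrite /cat_adj addbC eq_sym orbC.
by case: cat_pendant; case: cat_pendant.
Qed.

Lemma cat_adj_irr : irreflexive cat_adj.
Proof.
move=> x; rewrite /cat_adj addbb orbb; apply/negP => /andP[_ /eqP].
by move/(congr1 (subn^~ (cat_pos x))); rewrite subSn // subnn.
Qed.

Definition caterpillar := SGraph cat_adj_sym cat_adj_irr.

Lemma cat_node_inj (x y : cat_node) :
  cat_pos x = cat_pos y -> cat_pendant x = cat_pendant y -> x = y.
Proof.
move=> pos_xy pend_xy; apply: val_inj; move: pos_xy pend_xy.
rewrite /cat_pos /cat_pendant.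
by case: (val x) (val y) => [i b] [j c] /= /val_inj-> ->.
Qed.

Lemma cat_pos_le (x : cat_node) : cat_pos x <= n.
Proof. by rewrite -ltnS ltn_ord. Qed.

Lemma cat_pendant_interior (x : cat_node) : cat_pendant x -> 0 < cat_pos x < n.
Proof. exact/implyP/(valP x). Qed.

Definition cat_spine (i : nat) : cat_node :=
  exist (fun x : 'I_n.+1 * bool => x.2 ==> (0 < x.1 < n)) (inord i, false) isT.

(** The two ends of the path are leaves themselves, so only interior positions use the pendant node.
    For [i <= n] the pair is a valid node and the default of [insubd] is not taken. *)
Definition cat_leaf (i : nat) : cat_node :=
  insubd (cat_spine i) (inord i : 'I_n.+1, 0 < i < n).

Lemma cat_spine_pos i : i <= n -> cat_pos (cat_spine i) = i.
Proof. by move=> le_in; rewrite /cat_pos /= inordK. Qed.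

Lemma cat_leaf_val i : i <= n ->
  cat_pos (cat_leaf i) = i /\ cat_pendant (cat_leaf i) = (0 < i < n).
Proof.
move=> le_in; rewrite /cat_pos /cat_pendant /cat_leaf val_insubd /=.
by rewrite inordK // implybb inordK.
Qed.

Lemma cat_degree_interior (x : caterpillar) :
  ~~ cat_pendant x -> 0 < cat_pos x < n -> degree x = 3.
Proof.
move=> npx int; rewrite /degree.
set i := cat_pos x in int.
have [pl ql] := cat_leaf_val (ltac:(lia) : i <= n).
have pp := cat_spine_pos (ltac:(lia) : i.-1 <= n).
have pn := cat_spine_pos (ltac:(lia) : i.+1 <= n).
pose N := [:: cat_leaf i; cat_spine i.-1; cat_spine i.+1].
have uN : uniq N.
  rewrite /= !inE andbT negb_or -!andbA.
  apply/and3P; split; apply/eqP => /(congr1 cat_pos);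
    rewrite ?pl ?pp ?pn; lia.
rewrite -[3]/(size N) -(card_uniqP uN); apply: eq_card => y.
rewrite !inE /= /cat_adj (negbTE npx) /= -/i.
apply/idP/or3P => [|[]/eqP->]; last first.
- by rewrite pn /= eqxx.
- by rewrite pp /=; lia.
- by rewrite pl ql int.
case: (boolP (cat_pendant y)) => py.
  move/eqP=> xy; apply: Or31; apply/eqP/cat_node_inj; first by rewrite pl.
  by rewrite ql py int.
case/orP=> /eqP xy; [apply: Or33|apply: Or32];
  by apply/eqP/cat_node_inj; rewrite ?pn ?pp ?(negbTE py) //=; lia.
Qed.

Lemma cat_is_leaf (x : caterpillar) :
  is_leaf x = cat_pendant x || ~~ (0 < cat_pos x < n).
Proof.
case: (boolP (_ || _)) => [lx|]; last first.
  by rewrite negb_or negbK /is_leaf => /andP[px /(cat_degree_interior px)->].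
apply/card_le1_eqP => y z; rewrite !inE /= /cat_adj.
have := @cat_pendant_interior y; have := @cat_pendant_interior z.
have := cat_pos_le y; have := cat_pos_le z; move: lx.
case: (cat_pendant x) => /=; case py: (cat_pendant y);
  case pz: (cat_pendant z) => //=; rewrite ?andbF // => lx lz ly iz iy xy xz;
  apply: cat_node_inj; rewrite ?py ?pz //; lia.
Qed.

Lemma caterpillar_is_tree : is_tree caterpillar.
Proof.
split.
- by apply/card_gt0P; exists (cat_spine 0).
- have csym : connect_sym (@adj caterpillar)
    by apply/sym_connect_sym/cat_adj_sym.
  suff root x : connect (@adj caterpillar) (cat_spine 0) x.
    by move=> x y; apply: connect_trans (root y); rewrite csym.
  have spine i : i <= n ->
    connect (@adj caterpillar) (cat_spine 0) (cat_spine i).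
    elim: i => [|i IH] lt_in //; apply: connect_trans (IH (ltnW lt_in)) _.
    apply: connect1; rewrite /= /cat_adj /= !cat_spine_pos ?eqxx //.
    exact: ltnW.
  case: (boolP (cat_pendant x)) => px; last first.
    suff -> : x = cat_spine (cat_pos x) by apply/spine/cat_pos_le.
    apply: cat_node_inj; rewrite ?cat_spine_pos ?cat_pos_le //.
    exact: negbTE.
  apply: connect_trans (spine _ (cat_pos_le x)) _; apply: connect1.
  by rewrite /= /cat_adj px /= cat_spine_pos ?cat_pos_le.
(* Pendant nodes rank below the whole path, and path nodes are ranked by position. The only larger
   neighbour of a pendant node is its attachment point; that of a path node is its successor. *)
- apply: (@acyclic_of_rank caterpillar
    (fun x => if cat_pendant x then 0 else (cat_pos x).+1)) => [x y|x y z].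
    rewrite /= /cat_adj.
    by case: (cat_pendant x); case: (cat_pendant y) => //=; lia.
  rewrite /= /cat_adj.
  case: (cat_pendant x) => /=; case py: (cat_pendant y);
    case pz: (cat_pendant z) => //= xy xz *;
    apply: cat_node_inj; rewrite ?py ?pz //; lia.
Qed.

End Caterpillar.

Section OrderToBranchDecomposition.
Variables (G : sgraph) (s : seq G) (M : nat).
Hypotheses (s_uniq : uniq s) (s_all : forall v, v \in s).
Hypothesis G_gt0 : 0 < #|G|.

(** The path has one node for each vertex of [G], numbered from 0 to [n]. *)
Let n := #|G|.-1.

Let size_s : size s = n.+1.
Proof.
rewrite prednK // -(card_uniqP s_uniq); apply: eq_card => v.
by rewrite s_all.
Qed.

Let index_le v : index v s <= n.
Proof. by rewrite -ltnS -size_s index_mem. Qed.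

Let leaf v : caterpillar n := cat_leaf n (index v s).

Let leaf_pos v : cat_pos (leaf v) = index v s.
Proof. by case: (cat_leaf_val (index_le v)). Qed.

Let leaf_inj : injective leaf.
Proof.
move=> u v /(congr1 (@cat_pos n)); rewrite !leaf_pos.
exact: index_inj.
Qed.

Let leaf_codom (x : caterpillar n) : (x \in codom leaf) = is_leaf x.
Proof.
rewrite cat_is_leaf; apply/codomP/idP => [[v ->]|lx].
  by have [-> ->] := cat_leaf_val (index_le v); case: (_ && _).
have [v0 _] : exists v : G, true by case/card_gt0P: G_gt0 => v; exists v.
have lt_x : cat_pos x < size s by rewrite size_s ltnS cat_pos_le.
exists (nth v0 s (cat_pos x)); rewrite /leaf index_uniq //.
have [pos pend] := cat_leaf_val (cat_pos_le x).
apply: cat_node_inj; rewrite ?pos ?pend //.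
by move: lx; case: (boolP (cat_pendant x)) =>
  [/cat_pendant_interior->|_ /= /negbTE].
Qed.

Let internalP (x : caterpillar n) : ~~ is_leaf x -> degree x = 3.
Proof.
by rewrite cat_is_leaf negb_or negbK => /andP[]; apply: cat_degree_interior.
Qed.

Let D := BranchDec (caterpillar_is_tree n) internalP leaf_inj leaf_codom.

Let D_linear : linear_bd D.
Proof.
(* The internal nodes are at positions 1 to [n - 1]; there are none when [n <= 1]. *)
exists [seq cat_spine n i | i <- iota 1 n.-1] => /=; split.
- rewrite map_inj_in_uniq ?iota_uniq // => i j; rewrite !mem_iota => ii jj.
  by move/(congr1 (@cat_pos n)); rewrite !cat_spine_pos //; lia.
- apply/(sortedP (cat_spine n 0)) => i; rewrite size_map size_iota => lt_i.
  rewrite !(nth_map 0) ?size_iota ?(ltnW lt_i) // !nth_iota ?(ltnW lt_i) //.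
  by rewrite /cat_adj /= !cat_spine_pos; lia.
- move=> x; rewrite cat_is_leaf negb_or negbK.
  apply/mapP/andP => [[i + ->]|[px int]].
    by rewrite mem_iota => ii; rewrite cat_spine_pos; last lia; split=> //; lia.
  exists (cat_pos x); first by rewrite mem_iota; lia.
  by apply: cat_node_inj; rewrite ?cat_spine_pos ?cat_pos_le ?(negbTE px).
Qed.

(** A pendant edge cuts off one vertex and has at most two traces, whence [1 < M]. A path edge cuts
    off an initial segment of [s]. The reverse orientations follow from the symmetry of the number
    of traces. *)
Lemma branch_dec_of_order :
  (forall i, #|bool_traces [set v in take i s] (~: [set v in take i s])| <= M)
    ->
  1 < M ->
  exists2 D : branch_dec G, linear_bd D & forall x y : bd_tree D,
    adj x y -> #|bool_traces (side x y) (side y x)| <= M.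
Proof.
move=> cutM M_gt1; exists D => //.
have pendant_cut (x y : bd_tree D) : cat_pendant x -> ~~ cat_pendant y ->
    adj x y -> #|bool_traces (side x y) (side y x)| <= M.
  move=> px py xy.
  apply: leq_trans (@card_bool_traces_side G D x y [set x] _ _ _) _.
  - by rewrite inE.
  - by rewrite inE; apply: contraNneq py => ->.
  - move=> u v uv /set1P ux _; split=> //; apply: cat_node_inj;
      move: uv xy; rewrite ux /= /cat_adj px (negbTE py) /=;
      by case: (boolP (cat_pendant v)) => //= _ /eqP-> // /eqP->.
  - move=> /=; apply: leq_trans (card_bool_traces_le_pow _ _) _.
    apply: leq_trans M_gt1; rewrite -[2]/(2 ^ 1) leq_exp2l //.
    apply/card_le1_eqP => u v; rewrite !inE => /eqP ux /eqP vx.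
    by apply: leaf_inj; rewrite /= ux vx.
have spine_cut (x y : bd_tree D) : ~~ cat_pendant x -> ~~ cat_pendant y ->
    (cat_pos x).+1 = cat_pos y -> #|bool_traces (side x y) (side y x)| <= M.
  move=> px py xy.
  apply: leq_trans
    (@card_bool_traces_side G D x y [set u | cat_pos u <= cat_pos x] _ _ _) _.
  - by rewrite inE.
  - by rewrite inE; lia.
  - move=> u v; rewrite /= !inE /cat_adj.
    case pu: (cat_pendant u); case pv: (cat_pendant v) => //= uv ux vx;
      try lia.
    by split; apply: cat_node_inj;
      rewrite ?pu ?pv ?(negbTE px) ?(negbTE py) //; lia.
  - rewrite /= (_ : [set v | _] = [set v in take (cat_pos x).+1 s]) //.
    by apply/setP => v; rewrite !inE /= leaf_pos in_take.
move=> x y xy; have := xy; rewrite /= /cat_adj.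
case: (boolP (cat_pendant x)) => px; case: (boolP (cat_pendant y)) => py //=.
- by move=> _; apply: pendant_cut.
- by rewrite card_bool_tracesC => _; apply: pendant_cut; rewrite // adj_sym.
- case/orP=> /eqP xy'; first exact: spine_cut.
  by rewrite card_bool_tracesC; apply: spine_cut.
Qed.

End OrderToBranchDecomposition.

(** * From linear branch decompositions to orderings *)

Section LinearDecompositionToLayers.
Variables (G : sgraph) (D : branch_dec G) (M : nat).
Hypothesis G_gt2 : 2 < #|G|.
Implicit Types (x y u : bd_tree D) (v : G).

Let is_leaf_bd_leaf v : is_leaf (bd_leaf D v).
Proof. by rewrite -bd_leaf_codom codom_f. Qed.

(* Two adjacent leaves would form a connected component. *)
Lemma leaf_adj_internal v : exists2 y, ~~ is_leaf y & adj (bd_leaf D v) y.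
Proof.
set x := bd_leaf D v; apply: contrapT => none.
have nb_leaf y : adj x y -> is_leaf y.
  by move=> xy; apply/negP => /negP ny; apply: none; exists y.
have [_ T_conn _] := bd_treeP D.
have all_K y : y \in x |: neigh x.
  apply: connect_invariant (T_conn x y); last by rewrite setU11.
  move=> u w; rewrite !inE => /orP[/eqP->->|xu uw]; first by rewrite orbT.
  have /card_le1_eqP/(_ x w) := nb_leaf u xu.
  by rewrite !inE adj_sym xu uw => /(_ isT isT) ->; rewrite eqxx.
have: #|G| <= 2.
  rewrite -(card_codom (@bd_leaf_inj _ D)).
  apply: leq_trans (subset_leq_card _) (_ : #|x |: neigh x| <= 2).
    by apply/subsetP => y _; apply: all_K.
  rewrite cardsU1 -[2]/(1 + 1) leq_add ?leq_b1 //.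
  exact: is_leaf_bd_leaf.
by rewrite leqNgt G_gt2.
Qed.

(** A layer consists of vertices whose leaves are adjacent to one internal node, which has degree 3.
    The cut below layer [i.+1] is compared with the spine edge from position [i] to [i.+1]. *)
Lemma layers_of_linear_bd : linear_bd D -> 0 < M ->
  (forall x y, adj x y -> #|bool_traces (side x y) (side y x)| <= M) ->
  exists h : G -> nat, (forall j, #|[set v | h v == j]| <= 3) /\
    (forall j, #|bool_traces [set v | h v < j] (~: [set v | h v < j])| <= M).
Proof.
move=> [p [p_uniq p_path p_int]] M_gt0 cutM.
pose h v := find (@adj (bd_tree D) (bd_leaf D v)) p.
have h_lt v : h v < size p.
  rewrite -has_find; have [y ny xy] := leaf_adj_internal v.
  by apply/hasP; exists y; rewrite ?p_int.
have [v0 _] : exists v : G, true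
  by case/card_gt0P: (ltn_trans (isT : 0 < 2) G_gt2) => v; exists v.
pose x0 := bd_leaf D v0; pose P i := nth x0 p i.
have h_adj v : adj (bd_leaf D v) (P (h v)).
  by apply: nth_find; rewrite has_find; apply: h_lt.
have P_internal i : i < size p -> ~~ is_leaf (P i).
  by move=> lt_i; rewrite -p_int mem_nth.
have P_inj i j : i < size p -> j < size p -> P i = P j -> i = j.
  by move=> li lj /eqP; rewrite nth_uniq // => /eqP.
exists h; split=> j.
  case: (ltnP j (size p)) => [lt_j|le_j]; last first.
    rewrite (_ : [set v | _] = set0) ?cards0 //; apply/setP => v.
    by rewrite !inE; apply/negP => /eqP hv; have := h_lt v;
      rewrite hv ltnNge le_j.
  rewrite -(card_imset _ (@bd_leaf_inj _ D)).
  rewrite -(bd_internalP (P_internal j lt_j)).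
  apply/subset_leq_card/subsetP => _ /imsetP[v + ->].
  by rewrite !inE => /eqP <-; rewrite adj_sym.
case: j => [|i].
  rewrite (_ : [set v | _] = set0); last by apply/setP => v; rewrite !inE.
  by apply: leq_trans (card_bool_traces_le_pow _ _) _; rewrite cards0.
(* Beyond the last spine edge all vertices are below the cut, and the complement is empty. *)
case: (ltnP i.+1 (size p)) => [lt_i|le_i]; last first.
  rewrite card_bool_tracesC (_ : ~: _ = set0).
    by apply: leq_trans (card_bool_traces_le_pow _ _) _; rewrite cards0.
  by apply/setP => v; rewrite !inE (leq_trans (h_lt v)).
have adjP k : k.+1 < size p -> adj (P k) (P k.+1).
  by move/(sortedP x0): p_path; apply.
apply: leq_trans (cutM _ _ (adjP i lt_i)).
pose e := remove_edge (P i) (P i.+1).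
have e_sym : connect_sym e.
  by apply: sym_connect_sym => u w; rewrite /e /remove_edge adj_sym setUC.
(* A stretch of the spine that starts after position [i] or ends by it avoids the removed edge. *)
have e_path a k : a + k < size p -> (i < a) || (a + k <= i) ->
    connect e (P a) (P (a + k)).
  elim: k => [|k IH]; rewrite ?addn0 // addnS => lt_k side_k.
  apply: connect_trans (IH _ _) _; [lia|lia|].
  apply: connect1; rewrite /e /remove_edge adjP //=; apply/eqP => /setP E.
  have := E (P i); rewrite !inE eqxx /= => /orP[]/eqP/P_inj Ei.
    have := E (P i.+1); rewrite !inE eqxx orbT => /orP[]/eqP/P_inj; lia.
  have := E (P i.+1); rewrite !inE eqxx orbT => /orP[]/eqP/P_inj; lia.
(* The removed edge joins two internal nodes, so the edge at a leaf survives. *)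
have e_leaf v : connect e (P (h v)) (bd_leaf D v).
  apply: connect1; rewrite /e /remove_edge adj_sym h_adj /=.
  apply/eqP => /setP/(_ (bd_leaf D v)); rewrite !inE eqxx orbT => /esym.
  case/orP=> /eqP E; have := is_leaf_bd_leaf v;
    by rewrite E; apply/negP/P_internal => //; apply: ltnW.
apply: card_bool_traces_mono; apply/subsetP => v; rewrite !inE.
  rewrite ltnS => hv; apply: connect_trans (e_leaf v); rewrite -/e e_sym.
  have := e_path (h v) (i - h v); rewrite subnKC //; apply;
    last by rewrite leqnn orbT.
  exact: ltnW.
rewrite -leqNgt => hv.
rewrite (@eq_connect _ _ e); last first.
  by move=> u w; rewrite /e /remove_edge (setUC [set P i.+1]).
apply: connect_trans (e_leaf v).
have := e_path i.+1 (h v - i.+1); rewrite subnKC //; apply;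
  last by rewrite leqnn.
exact: h_lt.
Qed.

End LinearDecompositionToLayers.

(** * From partition sequences to orderings *)

Section NonSingletonParts.
Variable G : sgraph.
Implicit Types (A B S : {set G}) (P Q : {set {set G}}) (v x y : G).

Definition grouped P : {set G} := [set v | 1 < #|pblock P v|].

Lemma pblock_mem_partition P v : partition P [set: G] ->
  pblock P v \in P /\ v \in pblock P v.
Proof.
by move=> partP; rewrite mem_pblock pblock_mem ?(cover_partition partP) ?inE.
Qed.

Lemma pblock_ungrouped P v : partition P [set: G] -> v \notin grouped P ->
  pblock P v = [set v].
Proof.
move=> partP; rewrite inE -leqNgt => le1.
have [_ vB] := pblock_mem_partition v partP.
by apply/esym/eqP; rewrite eqEcard sub1set vB cards1.
Qed.

Lemma card_cover_red_pairs P : #|cover (red_pairs P)| <= #|red_pairs P| * 2.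
Proof.
apply: leq_trans (leq_card_cover _) _; rewrite -sum_nat_const.
apply: leq_sum => E; rewrite inE => /exists_inP[A _ /exists_inP[B _]].
by case/and3P=> _ _ /eqP->; rewrite cards2; case: (_ != _).
Qed.

(* A trace is determined by the non-singleton parts that the set meets and by
   its restriction to the singletons incident to red pairs. *)
Lemma card_bool_traces_grouped P : partition P [set: G] ->
  #|bool_traces (grouped P) (~: grouped P)| <= 2 ^ (2 * nb_red P).
Proof.
move=> partP; set U := grouped P.
pose Y := [set y | (y \notin U) && ([set y] \in cover (red_pairs P))].
have cardY : #|Y| <= #|red_pairs P| * 2.
  apply: leq_trans (card_cover_red_pairs P).
  rewrite -(card_imset _ set1_inj); apply/subset_leq_card/subsetP.
  by move=> _ /imsetP[y + ->]; rewrite inE => /andP[].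
(* Each red pair puts at most two singletons into [Y], so the exponents add up to at most
   [#|red_loops P| + 2 * #|red_pairs P|]. *)
apply: (@leq_trans (2 ^ #|red_loops P| * 2 ^ #|Y|)); last first.
  rewrite -expnD leq_exp2l // /nb_red; lia.
rewrite -!card_powerset -cardsX.
(* [F] decodes a trace: on [Y] it is stored explicitly, and elsewhere [S] may be replaced by the
   union of the non-singleton parts it meets. *)
pose F (q : {set {set G}} * {set G}) :=
  q.2 :|: ((neighs (cover q.1) :&: ~: U) :\: Y).
apply: leq_trans (leq_imset_card F _).
apply/subset_leq_card/subsetP => _ /bool_tracesP[S SU ->].
pose L := [set A in red_loops P | A :&: S != set0].
apply/imsetP; exists (L, neighs S :&: Y).
  by rewrite in_setX !powersetE subsetIr andbT; apply/subsetP => A;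
    rewrite inE => /andP[].
apply/setP => y; rewrite /F /= in_setI in_setU in_setI in_setD in_setI in_setC.
case: (boolP (y \in U)) => yU /=.
  rewrite !andbF orbF [y \in Y]inE yU andbF //.
rewrite !andbT; case: (boolP (y \in Y)) => yY; first by rewrite andbT orbF.
rewrite andbF /= !in_neighs; apply/exists_inP/exists_inP => -[x].
  move=> xS xy; exists x => //; apply/bigcupP; exists (pblock P x).
    have [BP xB] := pblock_mem_partition x partP.
    have := subsetP SU x xS; rewrite !inE BP => -> /=.
    by apply/set0Pn; exists x; rewrite inE xB.
  by case: (pblock_mem_partition x partP).
case/bigcupP=> A; rewrite 2!inE =>
  /andP[/andP[AP A2] /set0Pn[z /setIP[zA zS]]] xA xy.
exists z => //.
have yP : [set y] \in P.
  by rewrite -(pblock_ungrouped partP yU); case: (pblock_mem_partition y partP).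
(* Otherwise [A] and [[set y]] would be a red pair, putting [y] into [Y]. *)
have : homogeneous A [set y].
  apply: contraNT yY => nh; rewrite inE yU; apply/bigcupP.
  exists [set A; [set y]]; last by rewrite !inE eqxx orbT.
  rewrite inE; apply/exists_inP; exists A => //; apply/exists_inP;
    exists [set y] => //.
  by rewrite nh eqxx !andbT; apply: contraTneq A2 => ->; rewrite cards1.
case/orP=> /forall_inP hom.
  by move/forall_inP: (hom z zA); apply; rewrite inE.
move/forall_inP: (hom x xA) => /(_ y); rewrite inE eqxx xy.
by move/(_ isT).
Qed.

Lemma pblock_merge P A B v : partition P [set: G] -> A \in P -> B \in P ->
  A != B -> let Q := (A :|: B) |: (P :\ A :\ B) in
  (pblock P v \in [set A; B]) /\ pblock Q v = A :|: B \/
  pblock Q v = pblock P v.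
Proof.
move=> partP AP BP neqAB Q.
have trivQ := partition_trivIset (partition_merge partP AP BP neqAB).
have [CP vC] := pblock_mem_partition v partP.
case: (boolP (pblock P v \in [set A; B])) => CAB; [left; split=> //|right].
  apply: def_pblock => //; first by rewrite setU11.
  by rewrite inE; case/set2P: CAB => <-; rewrite vC ?orbT.
apply: def_pblock => //; move: CAB; rewrite !inE negb_or => /andP[-> ->].
by rewrite CP orbT.
Qed.

(** A newly grouped vertex was a singleton part, and that part must be one of the two merged
    ones. *)
Lemma grouped_merge P Q : partition P [set: G] -> merges P Q ->
  grouped P \subset grouped Q /\ #|grouped Q :\: grouped P| <= 2.
Proof.
move=> partP /exists_inP[A AP /exists_inP[B BP /andP[neqAB /eqP->]]].
have pb v := pblock_merge v partP AP BP neqAB.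
split.
  apply/subsetP => v; rewrite !inE; have [[+ ->]|-> //] := pb v.
  by case/set2P=> -> h; apply: (leq_trans h);
    rewrite subset_leq_card ?subsetUl ?subsetUr.
apply: (@leq_trans #|[set A; B]|); last by rewrite cards2; case: (_ != _).
rewrite -(card_imset _ set1_inj); apply/subset_leq_card/subsetP.
move=> _ /imsetP[v + ->]; rewrite in_setD => /andP[vP].
have [[+ _ _]|] := pb v; first by rewrite pblock_ungrouped.
by move: vP; rewrite !inE => /[swap] ->; case: (_ < _).
Qed.

Lemma layers_of_partition_seq (t : #|G|.-tuple {set {set G}}) :
  partition_seq t -> 0 < #|G| ->
  exists h : G -> nat, (forall j, #|[set v | h v == j]| <= 2) /\
    (forall j, #|bool_traces [set v | h v < j] (~: [set v | h v < j])|
               <= 2 ^ (2 * seq_width t)).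
Proof.
case/and4P=> /allP t_part /eqP t_head /eqP t_last t_merge G_gt0.
pose P i := nth set0 t i.
have size_t : size t = #|G| by rewrite size_tuple.
have PP i : i < #|G| -> partition (P i) [set: G].
  by move=> lt_i; apply/t_part/mem_nth; rewrite size_t.
have stepP i : i.+1 < #|G| -> merges (P i) (P i.+1).
  by rewrite -size_t; move/(sortedP set0): t_merge; apply.
have monoP i k : i + k < #|G| -> grouped (P i) \subset grouped (P (i + k)).
  elim: k => [|k IH]; rewrite ?addn0 // addnS => lt_k.
  apply: subset_trans (IH (ltnW lt_k)) _.
  by case: (grouped_merge (PP _ (ltnW lt_k)) (stepP _ lt_k)).
(* A vertex that is never grouped receives the default [#|G|], the length of [t]. *)
pose h v := find (fun Q => v \in grouped Q) t.
have h_le v : h v <= #|G| by rewrite -size_t find_size.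
have hP v : h v < #|G| -> v \in grouped (P (h v)).
  by rewrite -size_t -has_find => hv; apply: (nth_find set0 hv).
have hN v i : i < h v -> v \notin grouped (P i).
  by move=> lt_i; rewrite (before_find set0 lt_i).
exists h; split=> j.
  case: j => [|i].
    rewrite (_ : [set v | _] = set0) ?cards0 //; apply/setP => v; rewrite !inE.
    apply/negP => /eqP hv; have := hP v; rewrite hv => /(_ G_gt0).
    rewrite /P nth0 t_head inE (@def_pblock _ _ [set v]) ?cards1 ?inE //.
      exact: partition_trivIset (partition_set1 G).
    exact: imset_f.
  case: (ltnP i.+1 #|G|) => [lt_i|le_i].
    have [_ +] := grouped_merge (PP _ (ltnW lt_i)) (stepP _ lt_i).
    apply: leq_trans; apply/subset_leq_card/subsetP => v.
    rewrite !inE -!in_set => /eqP hv.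
    by have := hP v; have := hN v i; rewrite hv !inE => -> // ->.
  (* A vertex in such a layer is not grouped even in the last partition, whose only part is the
     whole vertex set; hence [G] has just one vertex. *)
  case: (set_0Vmem [set v | h v == i.+1]) => [->|[v]]; first by rewrite cards0.
  rewrite inE => /eqP hv; apply: leq_trans (max_card _) _.
  have := hN v #|G|.-1; rewrite hv prednK // => /(_ le_i).
  rewrite /P -(congr1 predn size_t) nth_last t_last inE -leqNgt
    (@def_pblock _ _ [set: G]) ?inE //.
    by rewrite cardsT => /leqW.
  exact: trivIset1.
have cut_trivial (Z : {set G}) : #|Z| = 0 ->
    #|bool_traces Z (~: Z)| <= 2 ^ (2 * seq_width t).
  by move=> Z0; apply: leq_trans (card_bool_traces_le_pow _ _) _;
    rewrite Z0 expn_gt0.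
case: j => [|i].
  by apply: cut_trivial; apply: eq_card0 => v; rewrite !inE.
case: (ltnP i #|G|) => [lt_i|le_i]; last first.
  rewrite card_bool_tracesC -{2}[[set v | _]]setCK; apply: cut_trivial.
  by apply: eq_card0 => v; rewrite !inE ltnS (leq_trans (h_le v)).
(* Grouped vertices stay grouped, so the first layers up to [i] together form [grouped (P i)]. *)
rewrite (_ : [set v | _] = grouped (P i)); last first.
  apply/setP => v; rewrite inE; apply/idP/idP => [|vi]; last first.
    by rewrite ltnNge; apply: contraL vi; apply: hN.
  rewrite ltnS => le_h; have := monoP (h v) (i - h v); rewrite subnKC //.
  by move=> /(_ lt_i)/subsetP; apply; apply/hP/(leq_ltn_trans le_h).
apply: leq_trans (card_bool_traces_grouped (PP i lt_i)) _.
rewrite leq_exp2l // leq_mul2l /=.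
by apply: (@leq_bigmax_seq _ t predT) => //; rewrite mem_nth ?size_t.
Qed.

End NonSingletonParts.

(** * Widths *)

Lemma log2_natr_le (R : realType) (m N : nat) : 0 < m ->
  (log2 (m%:R : R) <= N%:R)%R = (m <= 2 ^ N).
Proof.
move=> m_gt0; have ln2_gt0 : (0 < ln 2 :> R)%R by rewrite ln_gt0 // ltr1n.
rewrite /log2 ler_pdivrMr // mulr_natl -lnXn // ler_ln ?posrE ?exprn_gt0 ?ltr0n
  //.
by rewrite -natrX ler_nat.
Qed.

(** This replaces the real-valued width by trace counts in [nat]. *)
Lemma bd_width_le (R : realType) (G : sgraph) (D : branch_dec G) (N : nat) :
  (bd_width R D <= N%:R)%R <-> forall x y : bd_tree D, adj x y ->
    #|bool_traces (side x y) (side y x)| <= 2 ^ N.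
Proof.
have traces_gt0 (X Y : {set G}) : 0 < #|bool_traces X Y|.
  apply/card_gt0P; exists (neighs set0 :&: Y).
  by apply/bool_tracesP; exists set0; rewrite ?sub0set.
split=> [le_N x y xy|le_N].
  rewrite -(log2_natr_le R) //; apply: le_trans le_N.
  exact: (@le_bigmax_cond _ _ _ _ (x, y) _ (fun p =>
    boolcut R (side p.1 p.2) (side p.2 p.1))).
apply/bigmax_leP; split=> [|[x y] /= xy]; first by rewrite ler0n.
by rewrite log2_natr_le // le_N.
Qed.

Lemma lboolw_le (R : realType) (G : sgraph) (D : branch_dec G) (N : nat) :
  linear_bd D -> (forall x y : bd_tree D, adj x y ->
    #|bool_traces (side x y) (side y x)| <= 2 ^ N) ->
  (lboolw R G <= N%:R)%R.
Proof.
move=> linD le_N; have [_ min_D] := lboolwP R linD.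
by apply: le_trans (min_D D linD) _; apply/bd_width_le.
Qed.

(** Any order satisfies this crude bound. It settles graphs with at most two vertices and yields the
    witnesses that [ttwwP] and [lboolwP] ask for. *)
Lemma linear_order_exists (G : sgraph) (k : nat) : #|G| <= k ->
  exists s : seq G, [/\ uniq s, forall v, v \in s
    & forall i, #|bool_traces [set v in take i s] (~: [set v in take i s])|
                <= 2 ^ k].
Proof.
move=> le_k; exists (enum G); split=> [|v|i]; rewrite ?enum_uniq ?mem_enum //.
apply: leq_trans (card_bool_traces_le_pow _ _) _.
by rewrite leq_exp2l // (leq_trans (max_card _)).
Qed.

Lemma linear_bd_exists (G : sgraph) : 0 < #|G| ->
  exists D : branch_dec G, linear_bd D.
Proof.
move=> G_gt0; have [s [s_uniq s_all cut]] := linear_order_exists (leqnn #|G|).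
have [|D linD _] := branch_dec_of_order s_uniq s_all G_gt0 cut;
  last by exists D.
by rewrite -[1]/(2 ^ 0) ltn_exp2l.
Qed.

(** Layers of at most three vertices turn [2 ^ k] traces into at most [2 ^ (k + 3)] for the
    ordering, and this is the [M] of [partition_seq_of_order]. *)
Lemma ttww_le_of_linear_bd (G : sgraph) (D : branch_dec G) (k : nat) :
  0 < #|G| -> linear_bd D -> (forall x y : bd_tree D, adj x y ->
    #|bool_traces (side x y) (side y x)| <= 2 ^ k) ->
  ttww G <= (2 ^ (k + 3)).+1 ^ 2 + (2 ^ (k + 3)).+1.
Proof.
move=> G_gt0 linD cutD.
have [s [_ s_all cut]] : exists s : seq G, [/\ uniq s, forall v, v \in s
    & forall i, #|bool_traces [set v in take i s] (~: [set v in take i s])|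
                <= 2 ^ (k + 3)].
  case: (ltnP 2 #|G|) => [G_gt2|G_le2]; last first.
    by apply: linear_order_exists; lia.
  have [|h [fib cut]] := layers_of_linear_bd G_gt2 linD _ cutD.
    by rewrite expn_gt0.
  by rewrite expnD; apply: linear_order_of_layers fib cut.
have [t tP le_t] := partition_seq_of_order s_all cut G_gt0.
by have [_ min_t] := ttwwP tP; apply: leq_trans (min_t t tP) le_t.
Qed.

(** The term [2 * ttww G] is the exponent of the trace bound at the layers, and 2 is the size of a
    layer. *)
Lemma lboolw_le_of_ttww (R : realType) (G : sgraph) :
  0 < #|G| -> (lboolw R G <= (2 * ttww G + 2)%:R)%R.
Proof.
move=> G_gt0; have [s [_ s_all cut]] := linear_order_exists (leqnn #|G|).
have [t0 t0P _] := partition_seq_of_order s_all cut G_gt0.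
have [[t tP ->] _] := ttwwP t0P.
have [h [fib {}cut]] := layers_of_partition_seq tP G_gt0.
have [{}s [s_uniq {}s_all]] := linear_order_of_layers fib cut.
rewrite -expnD => {}cut.
have [|D linD cutD] := branch_dec_of_order s_uniq s_all G_gt0 cut.
  by rewrite -[1]/(2 ^ 0) ltn_exp2l // addn2.
exact: lboolw_le linD cutD.
Qed.

Lemma lboolw_empty (R : realType) (G : sgraph) :
  #|G| = 0 -> (lboolw R G <= 0)%R.
Proof.
move=> G0.
have [[D linD]|noD] := pselect (exists D : branch_dec G, linear_bd D).
  apply: (@lboolw_le R G D 0 linD) => x y _.
  by apply: leq_trans (card_bool_traces_le_pow _ _) _;
    rewrite leq_exp2l // -G0 max_card.
(* Without a decomposition the infimum ranges over the empty set and takes its default value 0. *)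
rewrite /lboolw (_ : (fun w => _) = classical_sets.set0) ?inf0 //.
by apply/classical_sets.seteqP; split=> // w [D linD _]; case: noD; exists D.
Qed.

(** The only candidate is the empty sequence, whose last element defaults to [set0] instead of [[set
    [set: G]]]; so [ttww] takes its default value. *)
Lemma ttww_empty (G : sgraph) : #|G| = 0 -> ttww G = 0.
Proof.
move=> G0; rewrite /ttww; case: pickP => // s0 /and4P[_ _ + _].
have: size s0 == 0 by rewrite size_tuple G0.
case: (tval s0) => // _ /eqP/setP/(_ [set: G]).
by rewrite !inE eqxx.
Qed.

Theorem theorem3p2 (R : realType) :
  exists f : nat -> nat, forall G : sgraph,
    (ttww G <= f `|Num.ceil (lboolw R G)|)%N /\
    (lboolw R G <= (f (ttww G))%:R)%R.
Proof.
(* The sum of the two bounds dominates each of them, so one function serves both directions. *)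
exists (fun k =>
  ((2 ^ (k + 3)).+1 ^ 2 + (2 ^ (k + 3)).+1) + (2 * k + 2))%N => G.
case: (posnP #|G|) => [G0|G_gt0].
  rewrite ttww_empty //; split=> //.
  by apply: le_trans (lboolw_empty R G0) _; rewrite ler0n.
split; last first.
  by apply: le_trans (lboolw_le_of_ttww R G_gt0) _; rewrite ler_nat leq_addl.
apply: leq_trans (leq_addr _ _).
have [D0 linD0] := linear_bd_exists G_gt0.
have [[D linD widthD] _] := lboolwP R linD0.
apply: (ttww_le_of_linear_bd G_gt0 linD); apply/(bd_width_le R);
  rewrite -widthD.
(* The absolute value of the ceiling is a natural number at least as large as the width, hence a
   valid exponent [k]. *)
apply: le_trans (ceil_ge _) _.
by rewrite natr_absz ler_int ler_norm.
Qed.
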